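(* Let $r$ be a positive integer and let $P$ be an $r$-differential poset with rank sizes $p_n = |P_n|$ and rank gaps $\Delta p_n = p_n - p_{n-1}$. Then $\Delta p_n \geq 2r$ holds in each of the following cases: (i) $r=1$ and $n \geq 4$; (ii) $r=2$ and $n \geq 3$; (iii) $r > 2$ and $n \geq 2$.
   Context: Let $P$ be an $\mathbb{N}$-graded poset with $n$-th rank $P_n$ ($n \ge 0$), and let $\lessdot$ denote its covering relation. Let $\mathbb{Q}P_n$ be the $\mathbb{Q}$-vector space with basis $P_n$ (with $P_{-1}=\emptyset$). The up and down operators $U_n : \mathbb{Q}P_n \to \mathbb{Q}P_{n+1}$ and $D_n : \mathbb{Q}P_n \to \mathbb{Q}P_{n-1}$ are the linear maps given for $x \in P_n$ by $U_n x = \sum_{y : x \lessdot y} y$ and $D_n x = \sum_{z : z \lessdot x} z$. For a positive integer $r$, an $r$-differential poset is a locally finite $\mathbb{N}$-graded poset $P$ with unique minimal element $\hat{0}$ (so $P_0=\{\hat 0\}$) such that the operators above are well defined (each element is covered by finitely many elements, so that all ranks are finite) and $D_{n+1}U_n - U_{n-1}D_n = r\cdot I$ on $\mathbb{Q}P_n$ for all $n \geq 0$. *)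

(* Defs.v *)
From HB Require Import structures.
From mathcomp Require Import all_boot all_order all_algebra finmap.
From mathcomp Require Import boolp classical_sets functions cardinality.

Set Implicit Arguments.
Unset Strict Implicit.
Unset Printing Implicit Defensive.

Import Order.TTheory GRing.Theory Num.Theory.

Local Open Scope classical_set_scope.
Local Open Scope ring_scope.

Section Posets.
Context {d : Order.disp_t} {P : porderType d}.
Implicit Types (x y z : P) (rk : P -> nat).

Definition covers x y : Prop :=
  (x < y)%O /\ forall z, ~ ((x < z)%O /\ (z < y)%O).

Definition minimal x : Prop := forall y, ~ (y < x)%O.

Definition locally_finite : Prop :=
  forall x y, finite_set [set z | (x <= z)%O /\ (z <= y)%O].

(* The existence of such an rk says that every maximal chain of P has the form
   x_0 <. x_1 <. x_2 <. ... (finite or infinite) with rk x_i = i. *)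
Record is_rank_function rk : Prop := IsRankFunction {
  rank_lt : forall x y, (x < y)%O -> (rk x < rk y)%N;
  rank_covers : forall x y, covers x y -> rk y = (rk x).+1;
  rank_minimal : forall x, minimal x -> rk x = 0%N
}.

(* P_k as a finite set. The index is an integer so that P_{-1} is available (and
   empty). fset_set sends infinite sets to the empty one, but every rank is
   finite in the posets considered below: see is_differential. *)
Definition layer rk (k : int) : {fset P} := fset_set [set x | (rk x)%:Z = k].

Definition rank_size rk (k : int) : nat := #|` layer rk k|.

Definition rank_gap rk (k : int) : int :=
  (rank_size rk k)%:Z - (rank_size rk (k - 1))%:Z.

End Posets.

Section FreeSpaces.
Context {d : Order.disp_t} {P : porderType d}.
Implicit Types (A B : {fset P}) (R : P -> P -> Prop).

(* QA, for a finite set A. The regular module rat^o is what makes the space of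
   finite functions a vector space over rat. *)
Definition QSpace A := {ffun A -> rat^o}.

Definition basis A (x : A) : QSpace A := [ffun y => (y == x)%:R].

(* The linear map QA -> QB sending x to the sum of the y in B with R x y. *)
Definition sum_related R A B (v : QSpace A) : QSpace B :=
  \sum_(x : A) v x *: \sum_(y : B | `[< R (val x) (val y) >]) basis y.

Fact sum_related_linear R A B : linear (@sum_related R A B).
Proof.
move=> a u v; rewrite /sum_related scaler_sumr -big_split /=.
by apply: eq_bigr => x _; rewrite !ffunE scalerDl scalerA.
Qed.

HB.instance Definition _ R A B :=
  GRing.isLinear.Build rat (QSpace A) (QSpace B) _ (@sum_related R A B)
    (@sum_related_linear R A B).

Fact sum_related_basis R A B (x : A) :
  @sum_related R A B (basis x) =
    \sum_(y : B | `[< R (val x) (val y) >]) basis y.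
Proof.
rewrite /sum_related (bigD1 x) //= ffunE eqxx scale1r [X in _ + X]big1 ?addr0 //.
by move=> y yx; rewrite ffunE (negbTE yx) scale0r.
Qed.

End FreeSpaces.

Section Operators.
Context {d : Order.disp_t} {P : porderType d} (rk : P -> nat).

Definition QLayer (k : int) := QSpace (layer rk k).

(* Source and target ranks are separate arguments, since for instance
   QLayer (n - 1 + 1) and QLayer n are not convertible. Up k l is the operator U_k
   when l = k + 1, and Down k l is the operator D_k when l = k - 1. *)
Definition Up (k l : int) : {linear QLayer k -> QLayer l} :=
  @sum_related _ _ (fun x y => covers x y) (layer rk k) (layer rk l).

Definition Down (k l : int) : {linear QLayer k -> QLayer l} :=
  @sum_related _ _ (fun x z => covers z x) (layer rk k) (layer rk l).

End Operators.

(* (P, rk) is an r-differential poset. Each element has finitely many upper covers,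
   so by induction all ranks are finite. *)
Record is_differential (d : Order.disp_t) (P : porderType d) (rk : P -> nat)
    (r : nat) : Prop := IsDifferential {
  diff_locally_finite : @locally_finite d P;
  diff_rank : is_rank_function rk;
  diff_bottom : exists! bot : P, minimal bot;
  diff_upper_covers : forall x : P, finite_set [set y | covers x y];
  diff_commutation : forall (n : nat) (v : QLayer rk n%:Z),
    Down rk (n%:Z + 1) n%:Z (Up rk n%:Z (n%:Z + 1) v)
      - Up rk (n%:Z - 1) n%:Z (Down rk n%:Z (n%:Z - 1) v) = r%:R *: v
}.

(* Main.v *)
(* Call an element x_n a thread element if its down-set is a chain
   bot = x_0 <. x_1 <. ... <. x_n. Each of the r atoms has at least two upper
   covers covering nothing else, and each such element has again one such upper
   cover, so there are 2r thread elements in every rank n >= 2. The orthogonal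
   projection onto the kernel of D_n is the sum over i of (-1)^i / (r^i i!) U^i D^i;
   it kills the image of U_(n-1), and its restriction to the span of the thread
   elements is a I + b J + c J', where J is block diagonal with r blocks of size
   2, and J and J' have all entries 1 in their blocks, resp. everywhere. This
   matrix is nonsingular as soon as a > 2|b|, which is where the conditions on n
   come from. Then the span of the thread elements meets the image of U_(n-1)
   trivially, and U_(n-1) is injective, whence p_(n-1) + 2r <= p_n. *)

Require Import Defs.
From mathcomp Require Import all_boot all_order all_algebra finmap.
From mathcomp Require Import boolp classical_sets cardinality.
From mathcomp Require Import zify ring lra.

Set Implicit Arguments.
Unset Strict Implicit.
Unset Printing Implicit Defensive.

Import Order.TTheory GRing.Theory Num.Theory.
Local Open Scope ring_scope.

(** * Linear algebra over the rationals and estimates for the coefficients *)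

Lemma card_le_of_lin_indep (I J : finType) (K : I -> J -> rat) :
  (forall v : I -> rat, (forall j, \sum_i v i * K i j = 0) ->
     forall i, v i = 0) ->
  (#|I| <= #|J|)%N.
Proof.
move=> Kinj; pose M : 'M[rat]_(#|I|, #|J|) :=
  \matrix_(i, j) K (enum_val i) (enum_val j).
suff /eqP <- : row_free M by apply: rank_leq_col.
apply: inj_row_free => v vM; apply/rowP => i; rewrite mxE.
rewrite -[i]enum_valK; apply: (Kinj (fun x => v 0 (enum_rank x))) => j.
move/rowP/(_ (enum_rank j)): vM; rewrite !mxE => vM; rewrite -[RHS]vM.
rewrite (reindex (@enum_val I predT)) /=; last first.
  by exists enum_rank => x _; [apply: enum_valK | apply: enum_rankK].
by apply: eq_bigr => x _; rewrite mxE enum_valK enum_rankK.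
Qed.

(* The coefficient of U^i D^i in the orthogonal projection onto the kernel of D. *)
Definition alt_coef (r i : nat) : rat := (-1) ^+ i / (r ^ i * i`!)%:R.

(** This recursion makes the commutator terms cancel in [sum_down_up_at_thread]. *)
Lemma alt_coefS (r i : nat) : (0 < r)%N ->
  alt_coef r i.+1 * (i.+1 * r)%:R = - alt_coef r i.
Proof.
move=> r0; rewrite /alt_coef expnS factS !natrM exprS.
have nz1 : (i`!)%:R != 0 :> rat by rewrite pnatr_eq0 -lt0n fact_gt0.
have nz2 : (r ^ i)%:R != 0 :> rat by rewrite pnatr_eq0 -lt0n expn_gt0 r0.
have nz3 : r%:R != 0 :> rat by rewrite pnatr_eq0 -lt0n.
have nz4 : 1 + i%:R != 0 :> rat by rewrite addrC natr1 pnatr_eq0.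
by field; apply/and4P.
Qed.

Lemma normr_alt_coef (r i : nat) : `|alt_coef r i| = (r ^ i * i`!)%:R^-1.
Proof.
rewrite /alt_coef normrM normrX normrN1 expr1n mul1r ger0_norm //.
by rewrite invr_ge0 ler0n.
Qed.

Lemma normr_alt_coefS (r i : nat) : (0 < r)%N ->
  `|alt_coef r i.+1| * (i.+1 * r)%:R = `|alt_coef r i|.
Proof.
move=> r0; rewrite -[RHS]normrN -(alt_coefS i r0) [RHS]normrM.
by congr (_ * _); rewrite ger0_norm ?ler0n.
Qed.

(** Induction on m: the next term costs at most the absolute value of [alt_coef r k.+1], half of the
    bound at hand; the other half suffices for the new bound because (k + 2) r >= 2. The base cases
    m = 2, 1, 0 are the least m that work for r = 1, r = 2, r > 2. *)
Lemma alt_sum_gt (r m : nat) :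
    [\/ r = 1%N /\ (2 <= m)%N, r = 2 /\ (1 <= m)%N | (2 < r)%N] ->
  2 * `|alt_coef r m.+1| < \sum_(i < m.+1) alt_coef r i.
Proof.
move=> h.
have r0 : (0 < r)%N by case: h => [[->]|[->]|/ltnW/ltnW].
have step k : 2 * `|alt_coef r k.+1| < \sum_(i < k.+1) alt_coef r i ->
    2 * `|alt_coef r k.+2| < \sum_(i < k.+2) alt_coef r i.
  move=> lt_k; rewrite big_ord_recr /=.
  have le2 : 2 <= (k.+2 * r)%:R :> rat by rewrite ler_nat; nia.
  have := normr_alt_coefS k.+1 r0.
  have := normr_ge0 (alt_coef r k.+2).
  have : - alt_coef r k.+1 <= `|alt_coef r k.+1| by rewrite -normrN ler_norm.
  nra.
have ind k0 : 2 * `|alt_coef r k0.+1| < \sum_(i < k0.+1) alt_coef r i ->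
    (k0 <= m)%N -> 2 * `|alt_coef r m.+1| < \sum_(i < m.+1) alt_coef r i.
  move=> base /subnKC <-; elim: (m - k0)%N => [|j IH]; first by rewrite addn0.
  by rewrite addnS; apply: step.
case: h => [[r1 m2]|[r2 m1]|r3].
- by apply: ind m2; rewrite normr_alt_coef !big_ord_recr big_ord0 r1 /alt_coef.
- by apply: ind m1; rewrite normr_alt_coef !big_ord_recr big_ord0 r2 /alt_coef.
apply: (ind 0%N) => //; rewrite normr_alt_coef big_ord_recr big_ord0 /=.
rewrite /alt_coef expn1 muln1 !expr0 expn0 !fact0 !mul1n invr1 add0r mulr1.
by rewrite ltr_pdivrMr ?ltr0n // mul1r ltr_nat.
Qed.

(** The eigenvalues of the system are among a, a + 2b and a + 2b + 2rc, all positive when a > 2|b|: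
    by [alt_coefS] the last is a + 2b - 2b/(m + 2). Adding the equations over a pair, then over all
    pairs, isolates them. *)
Lemma twin_system_zero (A : finType) (r m : nat) (v : A * bool -> rat) :
    (0 < r)%N -> #|A| = r ->
    2 * `|alt_coef r m.+1| < \sum_(i < m.+1) alt_coef r i ->
    (forall s, (\sum_(i < m.+1) alt_coef r i) * v s
       + alt_coef r m.+1 * (v (s.1, true) + v (s.1, false))
       + alt_coef r m.+2 * (\sum_t v t) = 0) ->
  forall s, v s = 0.
Proof.
move=> r0 cardA; set a := \sum_(i < _) _; set b := alt_coef r m.+1.
set c := alt_coef r m.+2; set S := \sum_t _ => lt_ba sys.
have bc : c * (m.+2 * r)%:R = - b by apply: alt_coefS.
have lbN : - b <= `|b| by rewrite -normrN ler_norm.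
have a0 : 0 < a by have := normr_ge0 b; lra.
have ab0 : 0 < a + 2 * b by lra.
have pair x : (a + 2 * b) * (v (x, true) + v (x, false)) + 2 * c * S = 0.
  by have /= := (sys (x, true), sys (x, false)) => -[? ?]; lra.
have SE : S = \sum_x (v (x, true) + v (x, false)).
  rewrite /S; transitivity (\sum_x \sum_(y : bool) v (x, y)).
    by rewrite pair_big /=; apply: eq_bigr => -[].
  by apply: eq_bigr => x _; rewrite big_bool.
have S0 : (a + 2 * b + 2 * r%:R * c) * S = 0.
  rewrite mulrDl {1}SE mulr_sumr.
  rewrite (eq_bigr (fun=> - (2 * c * S))); last first.
    by move=> x _; apply/eqP; rewrite -addr_eq0 pair.
  by rewrite sumr_const cardA -[_ *+ r]mulr_natl; ring.
have {}S0 : S = 0.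
  move/eqP: S0; rewrite mulf_eq0 => /orP[|/eqP//]; rewrite gt_eqF //.
  have : 2 * r%:R * c * m.+2%:R = - 2 * b.
    by rewrite natrM in bc; rewrite -(opprK b) -bc; ring.
  set q := 2 * r%:R * c; set M := m.+2%:R => qM.
  have M2 : 2 <= M :> rat by rewrite ler_nat.
  have lb : b <= `|b| by rewrite ler_norm.
  nra.
have P0 x : v (x, true) + v (x, false) = 0.
  move/eqP: (pair x); rewrite S0 mulr0 addr0 mulf_eq0 gt_eqF //=.
  by move/eqP.
move=> s; move/eqP: (sys s); rewrite P0 S0 !mulr0 !addr0 mulf_eq0 gt_eqF //=.
by move/eqP.
Qed.

Section Differential.
Local Open Scope classical_set_scope.
Context {d : Order.disp_t} {P : porderType d} {rk : P -> nat} {r : nat}.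
Context (hr : (0 < r)%N) (hP : is_differential rk r).
Implicit Types (x y z : P) (f g : P -> rat).

Let hrk := diff_rank hP.

(** * Finite ranks and the bottom element *)

(** Local finiteness makes an interval [y0, x] finite; an element of greatest rank in it, other than
    x, is covered by x. *)
Lemma exists_lower_cover x : (0 < rk x)%N -> exists y, covers y x.
Proof.
move=> x0; have [y0 y0x] : exists y, (y < x)%O.
  apply: contrapT => none; have /(rank_minimal hrk) rx : minimal x.
    by move=> y yx; apply: none; exists y.
  by rewrite rx in x0.
pose B := fset_set [set z | (y0 <= z)%O /\ (z <= x)%O].
have BE z : (z \in B) = ((y0 <= z)%O && (z <= x)%O).
  rewrite in_fset_set; last exact: diff_locally_finite hP _ _.
  by apply/idP/andP; rewrite inE.
pose C := [fset z in B | z != x]%fset.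
have y0C : y0 \in C.
  by rewrite !inE /= BE lexx (ltW y0x) /= (lt_eqF y0x).
have [|y []] := unstable.fset_nat_maximum rk (A := C).
  by apply/fset0Pn; exists y0.
rewrite !inE /= BE => /andP[/andP[y0y yx] y_x] ymax.
exists y; split=> [|z [yz zx]]; first by rewrite lt_neqAle y_x.
have /ymax : z \in C.
  by rewrite !inE /= BE (le_trans y0y (ltW yz)) (ltW zx) (lt_eqF zx).
by rewrite leqNgt (rank_lt hrk yz).
Qed.

Lemma finite_rank (k : nat) : finite_set [set x | rk x = k].
Proof.
elim: k => [|k IH].
  have [bot [_ bot_unique]] := diff_bottom hP.
  apply: (sub_finite_set (B := [set bot])) => [x /= x0|]; last exact: finite_set1.
  by apply/esym/bot_unique => y /(rank_lt hrk); rewrite x0.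
apply: (sub_finite_set (B := \bigcup_(x in [set x | rk x = k]) [set y | covers x y])).
  move=> y /= yk; have [|x xy] := @exists_lower_cover y; first by rewrite yk.
  by exists x => //=; have := rank_covers hrk xy; rewrite yk => -[].
by apply: bigcup_finite => // x _; apply: diff_upper_covers hP x.
Qed.

Lemma mem_layer x (k : int) : (x \in layer rk k) = ((rk x)%:Z == k).
Proof.
rewrite in_fset_set; first by apply/idP/eqP; rewrite inE.
case: k => k; last by apply: sub_finite_set (finite_set0 P) => y.
by apply: sub_finite_set (finite_rank k) => y /= [].
Qed.

Lemma rk_layer (k : int) (x : layer rk k) : (rk (val x))%:Z = k.
Proof. by apply/eqP; rewrite -mem_layer (valP x). Qed.

Lemma exists_bottom : {bot : P | (forall x, rk x = 0%N <-> x = bot)}.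
Proof.
apply: cid; have [bot [bot_min bot_unique]] := diff_bottom hP.
exists bot => x; split=> [x0|->]; last exact: rank_minimal hrk _ bot_min.
by apply/esym/bot_unique => y /(rank_lt hrk); rewrite x0.
Qed.

Definition bot : P := sval exists_bottom.

Lemma rk_eq0 x : rk x = 0%N <-> x = bot.
Proof. exact: (svalP exists_bottom). Qed.

(** * The operators U and D on functions, and injectivity of U *)

(* Acting on all functions P -> rat, not only on finitely supported ones, avoids
   transporting along equalities between ranks. *)
Definition up f y : rat :=
  \sum_(x : layer rk ((rk y)%:Z - 1) | `[< covers (val x) y >]) f (val x).

Definition down f x : rat :=
  \sum_(y : layer rk ((rk x)%:Z + 1) | `[< covers x (val y) >]) f (val y).

Lemma upE f y (k : int) : k + 1 = (rk y)%:Z ->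
  up f y = \sum_(x : layer rk k | `[< covers (val x) y >]) f (val x).
Proof. by rewrite /up => <-; rewrite addrK. Qed.

Lemma downE f x (k : int) : k = (rk x)%:Z + 1 ->
  down f x = \sum_(y : layer rk k | `[< covers x (val y) >]) f (val y).
Proof. by rewrite /down => <-. Qed.

Lemma sum_relatedE (R : P -> P -> Prop) (A B : {fset P}) (v : QSpace A) (b : B) :
  sum_related R B v b = \sum_(a : A | `[< R (val a) (val b) >]) v a.
Proof.
rewrite /sum_related sum_ffunE [RHS]big_mkcond; apply: eq_bigr => a _.
rewrite ffunE sum_ffunE /= big_mkcond (bigD1 b) //= big1 ?addr0.
  by rewrite ffunE eqxx; case: ifP; rewrite ?scaler0 // /GRing.scale /= mulr1.
move=> c cb; case: ifP => // _.
by rewrite ffunE eq_sym (negbTE cb).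
Qed.

(** Both sides at x depend only on f in the rank of x, so the differential relation is applied to
    the restriction of f to that rank. *)
Lemma down_up f x : down (up f) x = up (down f) x + r%:R * f x.
Proof.
have xL : x \in layer rk (rk x)%:Z by rewrite mem_layer.
pose v : QLayer rk (rk x)%:Z := [ffun y => f (val y)].
have /(congr1 (fun u : QLayer rk (rk x)%:Z => u [` xL]%fset)) :=
  diff_commutation hP v.
rewrite !ffunE /GRing.scale /= => <-.
set a := (X in X - _); set b := (X in _ - X).
suff [-> ->] : down (up f) x = a /\ up (down f) x = b by rewrite addrC subrK.
rewrite {}/a {}/b !sum_relatedE; split.
  rewrite (@downE _ _ _ erefl); apply: eq_bigr => y _.
  rewrite sum_relatedE (@upE _ _ (rk x)%:Z) ?rk_layer //.
  by apply: eq_bigr => z _; rewrite ffunE.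
rewrite (@upE _ _ ((rk x)%:Z - 1)) ?subrK //; apply: eq_bigr => y _.
rewrite sum_relatedE (@downE _ _ (rk x)%:Z) ?rk_layer ?subrK //.
by apply: eq_bigr => z _; rewrite ffunE.
Qed.

Lemma upE_nat f y (k : nat) : rk y = k.+1 ->
  up f y = \sum_(x : layer rk k | `[< covers (val x) y >]) f (val x).
Proof. by move=> yk; rewrite (@upE _ _ k%:Z) ?yk // intS addrC. Qed.

Lemma downE_nat f x (k : nat) : k = (rk x).+1 ->
  down f x = \sum_(y : layer rk k | `[< covers x (val y) >]) f (val y).
Proof. by move=> ->; rewrite (@downE _ _ (rk x).+1%:Z) // intS addrC. Qed.

Lemma up_bot f : up f bot = 0.
Proof.
apply: big1 => x; have bot0 : rk bot = 0%N by apply/rk_eq0.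
by have rx := rk_layer x; lia.
Qed.

Lemma downZ (a : rat) f : down (fun x => a * f x) = fun x => a * down f x.
Proof. by apply/funext => x; rewrite /down mulr_sumr. Qed.

Lemma downD f g : down (fun x => f x + g x) = fun x => down f x + down g x.
Proof. by apply/funext => x; rewrite /down big_split. Qed.

Lemma iter_down_up f (i : nat) x : iter i down (up f) x =
  up (iter i down f) x + (i * r)%:R * iter i.-1 down f x.
Proof.
(* At i = 0 the truncated [i.-1] is multiplied by zero. *)
elim: i x => [|i IH] x; first by rewrite mul0n mul0r addr0.
rewrite iterS (funext IH) downD downZ down_up -addrA; congr (_ + _).
case: i {IH} => [|i] /=; first by rewrite mul0n mul0r addr0 mul1n.
by rewrite -mulrDl -natrD -mulSn.
Qed.

(* If f is an eigenvector of U D for -c r, then down f is one for -(c + 1) r. *)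
Lemma eigen_eq0 f (k c : nat) : (forall x, (k <= rk x)%N -> f x = 0) ->
  (forall x, up (down f) x = - (c.+1 * r)%:R * f x) -> forall x, f x = 0.
Proof.
elim: k f c => [|k IH] f c f0 fE x; first exact: f0.
(* If f vanishes from rank k + 1 on, then D f vanishes from rank k on, so the induction applies to
   it. Then U D f = 0, and the nonzero eigenvalue gives f = 0. *)
have df0 : forall x, down f x = 0.
  apply: (IH _ c.+1) => [y ky|y].
    apply: big1 => z _; apply: f0; have := rk_layer z; lia.
  apply: (addIr (r%:R * down f y)); rewrite -down_up (funext fE) downZ.
  by rewrite -mulrDl [(c.+2 * r)%N]mulSn natrD opprD addrAC addNr add0r.
have := fE x; rewrite /up big1 => [/esym/eqP|y _]; last exact: df0.
by rewrite mulf_eq0 oppr_eq0 pnatr_eq0 muln_eq0 (gtn_eqF hr) => /eqP.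
Qed.

(** From U f = 0 follows U D f = D U f - r f = - r f, the case c = 0 of [eigen_eq0]. *)
Lemma up_eq0 f (k : nat) : (forall x, (k <= rk x)%N -> f x = 0) ->
  (forall x, up f x = 0) -> forall x, f x = 0.
Proof.
move=> f0 uf0; apply: (@eigen_eq0 f k 0) => // x.
apply: (addIr (r%:R * f x)); rewrite -down_up mul1n mulNr addNr.
by apply: big1.
Qed.

(** * Point masses and numbers of lower covers *)

Lemma mem_layer_nat x (k : nat) : (x \in layer rk k) = (rk x == k).
Proof. by rewrite mem_layer. Qed.

Lemma rk_bot : rk bot = 0%N.
Proof. exact/rk_eq0. Qed.

Definition delta x : P -> rat := fun y => (x == y)%:R.

Lemma sum_delta (A : {fset P}) (Q : pred A) x (xA : x \in A) :
  \sum_(a : A | Q a) delta x (val a) = (Q [` xA]%fset)%:R.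
Proof.
rewrite big_mkcond (bigD1 [` xA]%fset) //= big1 ?addr0 => [|a ax].
  by rewrite /delta eqxx; case: ifP.
by case: ifP => // _; rewrite /delta -val_eqE /= eq_sym in ax *; rewrite (negbTE ax).
Qed.

Lemma up_delta x y : up (delta x) y = `[< covers x y >]%:R.
Proof.
case: (pselect (covers x y)) => [xy|nxy].
  have yk := rank_covers hrk xy.
  have xL : x \in layer rk (rk x) by rewrite mem_layer_nat.
  by rewrite (upE_nat _ yk) (sum_delta _ xL).
rewrite asboolF // /up big1 // => z /asboolP zy.
by rewrite /delta; case: eqP => // xz; case: nxy; rewrite xz.
Qed.

Lemma down_delta x y : down (delta y) x = `[< covers x y >]%:R.
Proof.
case: (pselect (covers x y)) => [xy|nxy].
  have yk := rank_covers hrk xy.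
  have yL : y \in layer rk (rk y) by rewrite mem_layer_nat.
  by rewrite (downE_nat _ yk) (sum_delta _ yL).
rewrite asboolF // /down big1 // => z /asboolP xz.
by rewrite /delta; case: eqP => // yz; case: nxy; rewrite yz.
Qed.

Definition covers_only x y := forall z, covers z y <-> z = x.

Lemma up_covers_only f x y : covers_only x y -> up f y = f x.
Proof.
move=> xy; have cxy : covers x y by apply/xy.
have xL : x \in layer rk (rk x) by rewrite mem_layer_nat.
rewrite (upE_nat _ (rank_covers hrk cxy)) (big_pred1 [` xL]%fset) // => z.
by rewrite [RHS]inE -val_eqE /=; apply/asboolP/eqP => /xy.
Qed.

Lemma down_delta_covers_only x y : covers_only x y -> down (delta y) = delta x.
Proof.
move=> xy; apply/funext => z; rewrite down_delta /delta eq_sym; congr (_%:R).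
by congr nat_of_bool; apply/asboolP/eqP => /xy.
Qed.

Definition lower_degree y : nat :=
  #|[pred x : layer rk ((rk y)%:Z - 1) | `[< covers (val x) y >]]|.

Lemma up_const1 y : up (fun=> 1) y = (lower_degree y)%:R.
Proof. by rewrite /up sumr_const. Qed.

(** Evaluating D U and U D of the point mass at x, at x itself, counts the upper and the lower
    covers of x. *)
Lemma down_const1 x : down (fun=> 1) x = (lower_degree x + r)%:R.
Proof.
have := down_up (delta x) x; rewrite {3}/delta eqxx mulr1 natrD -up_const1.
rewrite /(down (up _) _) /(up (down _) _).
under eq_bigr => y xy do rewrite up_delta xy.
by under [X in _ = X + _ -> _]eq_bigr => y yx do rewrite down_delta yx.
Qed.

Lemma lower_degree_gt0 x y : covers x y -> (0 < lower_degree y)%N.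
Proof.
move=> xy; apply/card_gt0P; have xL : x \in layer rk ((rk y)%:Z - 1).
  by rewrite mem_layer (rank_covers hrk xy) intS addrAC subrr add0r.
by exists [` xL]%fset; apply/asboolP.
Qed.

Lemma lower_degree_eq1 x y : covers x y -> lower_degree y = 1%N ->
  covers_only x y.
Proof.
move=> xy /mem_card1[/= x0 x0E] z.
have mL w : covers w y -> w \in layer rk ((rk y)%:Z - 1).
  by move=> wy; rewrite mem_layer (rank_covers hrk wy) intS addrAC subrr add0r.
have only w : covers w y -> w = val x0.
  move=> wy; have := x0E [` mL _ wy]%fset; rewrite !inE asboolT //.
  by move=> /esym/eqP <-.
by split=> [zy|->//]; rewrite (only _ zy) (only _ xy).
Qed.

Lemma lower_degree_covers_only x y : covers_only x y -> lower_degree y = 1%N.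
Proof.
move=> xy; apply/eqP; rewrite -(eqr_nat rat) -up_const1.
by rewrite (up_covers_only _ xy).
Qed.

Lemma lower_degree_bot : lower_degree bot = 0%N.
Proof. by apply/eqP; rewrite -(eqr_nat rat) -up_const1 up_bot. Qed.

(* By [down_up] applied to the constant 1, the lower degrees of the r + 1 upper
   covers of x sum to 2r + lower_degree z only, so few of them exceed 1. *)
Lemma card_covers_only z x : covers_only z x ->
  (2 <= #|[pred y : layer rk ((rk x)%:Z + 1) |
            `[< covers_only x (val y) >]]| + lower_degree z)%N.
Proof.
move=> zx; pose C := [pred y : layer rk ((rk x)%:Z + 1) | `[< covers x (val y) >]].
have cardC : #|C| = r.+1.
  apply/eqP; rewrite -(eqr_nat rat) -sumr_const; apply/eqP.
  by have := down_const1 x; rewrite (lower_degree_covers_only zx) add1n.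
(* The sum is D U 1 at x, that is U D 1 + r; as x covers only z, U D 1 at x equals D 1 at z. *)
have sumC : (\sum_(y in C) lower_degree (val y) = lower_degree z + r + r)%N.
  apply/eqP; rewrite -(eqr_nat rat) natr_sum natrD -down_const1.
  rewrite -(up_covers_only (down (fun=> 1)) zx) -[r%:R]mulr1 -down_up.
  by apply/eqP/eq_bigr => y _; rewrite up_const1.
set N := #|_|.
have sumN : (\sum_(y in C) `[< covers_only x (val y) >] = N)%N.
  rewrite -big_mkcondr /N -sum1_card; apply: eq_bigl => y.
  rewrite !inE; apply/andP/idP => [[]//|xy]; split=> //.
  by move/asboolP: xy => xy; apply/asboolP/xy.
(* An upper cover of x with lower degree 1 covers only x, so each of the r + 1 upper covers
   contributes at least 2. *)
have : (\sum_(y in C) 2 <= \sum_(y in C) (lower_degree (val y)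
          + `[< covers_only x (val y) >]))%N.
  apply: leq_sum => y /asboolP xy; have := lower_degree_gt0 xy.
  case: (eqVneq (lower_degree (val y)) 1%N) => [y1 _|]; last first.
    move: (lower_degree _) => e e1 e0; apply: leq_trans (leq_addr _ _); lia.
  by rewrite y1 asboolT //; apply: lower_degree_eq1.
by rewrite big_split /= sumC sumN sum_nat_const cardC; lia.
Qed.

Lemma exists_covers_only y x : covers_only y x -> (lower_degree y <= 1)%N ->
  exists w, covers_only x w.
Proof.
move=> yx y1; have := card_covers_only yx => c2.
have /card_gt0P[w /asboolP xw] : (0 < #|[pred y : layer rk ((rk x)%:Z + 1) |
            `[< covers_only x (val y) >]]|)%N by lia.
by exists (val w).
Qed.

Lemma exists_two_covers_only x : covers_only bot x ->
  exists w : P * P, [/\ w.1 != w.2, covers_only x w.1 & covers_only x w.2].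
Proof.
move=> /card_covers_only; rewrite lower_degree_bot addn0.
case/card_gt1P => w1 [w2 [/asboolP xw1 /asboolP xw2 w12]].
by exists (val w1, val w2).
Qed.

(** * Atoms and threads *)

Lemma covers_only_bot (x : layer rk 1%N) : covers_only bot (val x).
Proof.
have x1 := rk_layer x.
have cb z : covers z (val x) -> z = bot.
  by move/(rank_covers hrk) => zx; apply/rk_eq0; lia.
move=> z; split=> [|->]; first exact: cb.
have [|y yx] := @exists_lower_cover (val x); first by lia.
by rewrite -(cb _ yx).
Qed.

Lemma card_atoms : #|{: layer rk 1%N}| = r.
Proof.
apply/eqP; rewrite -(eqr_nat rat); apply/eqP.
have := down_const1 bot; rewrite lower_degree_bot add0n => <-.
rewrite (@downE_nat _ _ 1) ?rk_bot // big_mkcond /= -sumr_const.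
by apply: eq_bigr => x _; rewrite asboolT //; apply/covers_only_bot.
Qed.

Lemma exists_threads : exists T : layer rk 1%N * bool -> nat -> P,
  [/\ forall t, T t 0%N = bot,
      forall t, T t 1%N = val t.1,
      forall t k, covers_only (T t k) (T t k.+1) &
      forall t s k, T t k.+2 = T s k.+2 -> t = s].
Proof.
(* Above two consecutive links a thread goes on by [exists_covers_only]; where there are no such
   links, [next] takes the junk value x. *)
have /choice[next nextP] : forall x, exists w, forall y z,
    covers_only y x -> covers_only z y -> covers_only x w.
  move=> x; case: (pselect (exists y z, covers_only y x /\ covers_only z y)).
    case=> y [z [yx zy]]; have [|w xw] := exists_covers_only yx.
      by rewrite (lower_degree_covers_only zy).
    by exists w.
  by move=> none; exists x => y z yx zy; case: none; exists y, z.
have /choice[pair pairP] :=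
  fun x : layer rk 1%N => exists_two_covers_only (covers_only_bot x).
pose T2 (t : layer rk 1%N * bool) := if t.2 then (pair t.1).1 else (pair t.1).2.
have T2P t : covers_only (val t.1) (T2 t).
  by rewrite /T2; have [_] := pairP t.1; case: t.2.
pose T t k := if k is k'.+1 then
  if k' is k''.+1 then iter k'' next (T2 t) else val t.1 else bot.
have TP t k : covers_only (T t k) (T t k.+1) /\
              covers_only (T t k.+1) (T t k.+2).
  elim: k => [|k [IH1 IH2]]; first by split; [apply: covers_only_bot|apply: T2P].
  by split=> //; apply: nextP IH2 IH1.
have TPl t k := (TP t k).1.
(* Equal elements have equal unique lower covers, so an equality descends to rank 2 and then to the
   atoms; [pairP] separates the two threads through one atom. *)
exists T; split=> // t s; elim=> [|k IH] eqT; last first.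
  by apply: IH; apply/(TPl s); rewrite -eqT; apply/(TPl t).
have t1 : t.1 = s.1.
  by apply/val_inj/(T2P s); rewrite -[T2 s]eqT; apply/(T2P t).
case: t s t1 eqT => [x b] [y c] /= <- {y}; rewrite /T2 /=.
by case: (pairP x) => /eqP ne _ _; case: b; case: c => // /esym.
Qed.

(** * The projection along threads and the growth of ranks *)

(* On threads, U^i g (T n) = g (T (n - i)): this is the projection applied to
   up f, evaluated at T n.+1. *)
Lemma sum_down_up_at_thread f (T : nat -> P) (n : nat) :
    T 0%N = bot -> (forall k, covers_only (T k) (T k.+1)) ->
  \sum_(i < n.+2) alt_coef r i * iter i down (up f) (T (n.+1 - i)%N) = 0.
Proof.
move=> T0 TP; pose e j := iter j down f (T (n.+1 - j.+1)%N).
(* What the terms up to index i leave, a multiple of U D^i f, is cancelled by the commutator term of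
   index i + 1; the last remainder vanishes at [bot]. *)
have partial m : (m <= n)%N ->
    \sum_(i < m.+1) alt_coef r i * iter i down (up f) (T (n.+1 - i)%N) =
      alt_coef r m * e m.
  elim: m => [|m IH] mn.
    rewrite big_ord_recr big_ord0 /= add0r subn0 (up_covers_only _ (TP n)).
    by rewrite /e /= subn1.
  rewrite big_ord_recr /= IH ?(ltnW mn) // -iterS iter_down_up mulrDr mulrA.
  rewrite alt_coefS // mulNr /= -/(e m) addrCA subrr addr0.
  have -> : (n.+1 - m.+1)%N = (n.+1 - m.+2).+1 by lia.
  by rewrite (up_covers_only _ (TP _)).
rewrite big_ord_recr /= partial // -iterS iter_down_up mulrDr mulrA alt_coefS //.
rewrite mulNr -/(e n) addrCA subrr addr0 subnn T0 up_bot; exact: mulr0.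
Qed.

Lemma rk_thread (T : nat -> P) : T 0%N = bot ->
  (forall k, covers_only (T k) (T k.+1)) -> forall k, rk (T k) = k.
Proof.
move=> T0 TP; elim=> [|k IH]; first by rewrite T0 rk_bot.
by rewrite (@rank_covers _ _ _ hrk (T k)) ?IH //; apply/TP.
Qed.

Lemma rank_growth (m : nat) :
    2 * `|alt_coef r m.+1| < \sum_(i < m.+1) alt_coef r i ->
  (#|{: layer rk m.+1}| + 2 * r <= #|{: layer rk m.+2}|)%N.
Proof.
move=> coef; have [T [T0 T1 TP Tinj]] := exists_threads.
have rkT t k : rk (T t k) = k by apply: rk_thread (T0 t) (TP t) k.
pose I := (layer rk m.+1 + layer rk 1%N * bool)%type.
have <- : #|{: I}| = (#|{: layer rk m.+1}| + 2 * r)%N.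
  by rewrite card_sum card_prod card_bool card_atoms mulnC.
(* The rows are the vectors U x for x of rank m + 1 and the thread elements of rank m + 2. *)
pose K (i : I) (y : layer rk m.+2) : rat := match i with
  | inl x => `[< covers (val x) (val y) >]%:R
  | inr t => delta (T t m.+2) (val y) end.
apply: (@card_le_of_lin_indep _ _ K) => v vK.
(* A vanishing combination of the rows reads U u + [w m.+2] = 0; [w k] is its thread part brought
   down to rank k. *)
pose u x : rat := if insub x is Some x' then v (inl x') else 0.
pose w k x := \sum_t v (inr t) * delta (T t k) x.
have uE (x : layer rk m.+1) : u (val x) = v (inl x) by rewrite /u valK.
have u0 x : rk x != m.+1 -> u x = 0.
  by move=> xm; rewrite /u insubN // mem_layer_nat.
have uw0 x : up u x + w m.+2 x = 0.
  case: (eqVneq (rk x) m.+2) => [xm|xm].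
    have xL : x \in layer rk m.+2 by rewrite mem_layer_nat xm.
    have := vK [` xL]%fset; rewrite big_sumType /= => <-.
    congr (_ + _); rewrite (upE_nat _ xm) big_mkcond /=.
    by apply: eq_bigr => y _; rewrite uE; case: ifP; rewrite ?mulr1 ?mulr0.
  rewrite /w big1 => [|t _]; last first.
    by rewrite /delta; case: eqP => [tx|]; rewrite ?mulr0 // -tx rkT eqxx in xm *.
  rewrite addr0 /up big1 // => y _; apply: u0.
  by have := rk_layer y; lia.
have down_w k : down (w k.+1) = w k.
  apply/funext => x; rewrite /w -[RHS]/(\sum_t v (inr t) * delta (T t k) x).
  under [RHS]eq_bigr => t _ do
    rewrite -(down_delta_covers_only (TP t k)) /down mulr_sumr.
  by rewrite exchange_big.
have iter_w i : (i <= m.+2)%N -> iter i down (w m.+2) = w (m.+2 - i)%N.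
  elim: i => [|i IH] im; first by rewrite subn0.
  by rewrite iterS IH ?(ltnW im) // (_ : m.+2 - i = (m.+2 - i.+1).+1)%N ?down_w //; lia.
have up_uE : up u = fun x => -1 * w m.+2 x.
  by apply/funext => x; apply/eqP; rewrite mulN1r -addr_eq0 uw0.
have iter_u i : (i <= m.+2)%N -> iter i down (up u) =
    fun x => -1 * w (m.+2 - i)%N x.
  move=> im; rewrite -(iter_w i im) up_uE.
  by elim: i {im} => [//|i IH]; rewrite iterS IH downZ.
(* From rank 2 on the threads are distinct; at rank 1 the two threads through an atom merge, at rank
   0 all of them. Hence the blocks with coefficients a, b, c. *)
have w_ge2 k s : w k.+2 (T s k.+2) = v (inr s).
  rewrite /w (bigD1 s) //= /delta eqxx mulr1 big1 ?addr0 // => t ts.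
  by case: eqP => [/Tinj tE|]; rewrite ?mulr0 // tE eqxx in ts *.
have w1 s : w 1%N (T s 1%N) = v (inr (s.1, true)) + v (inr (s.1, false)).
  rewrite /w; transitivity (\sum_x \sum_(b : bool)
      v (inr (x, b)) * delta (T (x, b) 1%N) (T s 1%N)).
    by rewrite pair_big /=; apply: eq_bigr => -[].
  rewrite (bigD1 s.1) //= [X in _ + X]big1 => [|x xs].
    by rewrite big_bool /delta !T1 eqxx !mulr1 addr0.
  by rewrite big1 // => b _; rewrite /delta !T1 (inj_eq val_inj) (negbTE xs) mulr0.
have w0 s : w 0%N (T s 0%N) = \sum_t v (inr t).
  by apply: eq_bigr => t _; rewrite /delta !T0 eqxx mulr1.
(* The projection kills U u = - [w m.+2]; its values at the thread elements give the system of
   [twin_system_zero]. *)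
have v_thread s : v (inr s) = 0.
  apply: (@twin_system_zero _ _ m (fun t => v (inr t)) hr card_atoms coef) => {}s.
  have := sum_down_up_at_thread u m.+1 (T0 s) (TP s).
  rewrite (eq_bigr (fun i : 'I_m.+3 => - (alt_coef r i *
    w (m.+2 - i)%N (T s (m.+2 - i)%N)))); last first.
    by move=> i _; rewrite iter_u -1?ltnS // mulN1r mulrN.
  rewrite sumrN => /eqP; rewrite oppr_eq0 => /eqP sumE.
  rewrite 2!big_ord_recr /= subnn subSnn w0 w1 in sumE.
  rewrite -[RHS]sumE; congr (_ + _ + _); rewrite mulr_suml.
  apply: eq_bigr => i _; have im := ltn_ord i.
  by rewrite (_ : m.+2 - i = (m - i).+2)%N ?w_ge2 //; lia.
(* Now U u = 0, and u is supported in the single rank m + 1. *)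
have u_zero x : u x = 0.
  apply: (@up_eq0 _ m.+2) => y; first by move=> my; apply: u0; lia.
  by rewrite up_uE /w big1 ?mulr0 // => t _; rewrite v_thread mul0r.
by case=> [x|t]; rewrite ?v_thread // -uE u_zero.
Qed.

End Differential.

Theorem theorem1p4 (d : Order.disp_t) (P : porderType d) (rk : P -> nat)
    (r : nat) (hr : (0 < r)%N) (hP : is_differential rk r) (n : nat)
    (hn : [\/ r = 1%N /\ (4 <= n)%N,
              r = 2%N /\ (3 <= n)%N
            | (2 < r)%N /\ (2 <= n)%N]) :
  (2 * r)%:Z <= rank_gap rk n%:Z.
Proof.
have n2 : (1 < n)%N by case: hn => -[_]; lia.
case: n n2 hn => [|[|m]] // _ hn.
(* With n = m + 2 the three cases become m >= 2, m >= 1 and m >= 0. *)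
have /(rank_growth hr hP) : 2 * `|alt_coef r m.+1| < \sum_(i < m.+1) alt_coef r i.
  apply: alt_sum_gt; case: hn => -[r_eq m_ge].
  - by constructor 1; split=> //; lia.
  - by constructor 2; split=> //; lia.
  - by constructor 3.
rewrite -!cardfE /rank_gap /rank_size.
have -> : m.+2%:Z - 1 = m.+1%:Z by lia.
by lia.
Qed.
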